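(* Let $(a_n)_{n\ge 0}$ be Stern's sequence, defined by $a_0=0$, $a_1=1$, $a_{2n}=a_n$, $a_{2n+1}=a_n+a_{n+1}$ for $n\ge 1$, and let $(b_n)_{n\ge0}$ be its twisted version, defined by $b_0=0$, $b_1=1$, $b_{2n}=-b_n$, $b_{2n+1}=-(b_n+b_{n+1})$ for $n\ge 1$. Put $A(z)=\sum_{n\ge0}a_{n+1}z^n$ and $B(z)=\sum_{n\ge0}b_{n+1}z^n$. Then for every integer $b\ge 2$, \[\mu\left(A\left(\tfrac1b\right),B\left(\tfrac1b\right)\right)\le \tfrac85 .\] Moreover, if $a/b\in\mathbb{Q}$ with $a,b$ integers, $b\ge 2$, $\log|a|=\lambda\log b$ and $0\le\lambda<50/77$, then \[\mu\left(A\left(\tfrac ab\right),B\left(\tfrac ab\right)\right)\le \frac{80(1-\lambda)}{50-77\lambda}.\]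
   Context: For real numbers $\alpha_1,\dots,\alpha_n$, the simultaneous approximation exponent $\mu(\alpha_1,\dots,\alpha_n)$ is the supremum of the real numbers $\mu$ such that the inequality $\max_{1\le i\le n}|\alpha_i-p_i/q|<q^{-\mu}$ has infinitely many solutions in rational numbers $p_i/q$ (with common denominator $q\ge1$). The power series $A(z)$ and $B(z)$ converge in the open unit disc. *)

(* Defs.v *)
From HB Require Import structures.
From mathcomp Require Import all_boot all_order all_algebra.
From mathcomp Require Import all_classical all_reals all_analysis.
Set Implicit Arguments. Unset Strict Implicit. Unset Printing Implicit Defensive.
Import Order.TTheory GRing.Theory Num.Theory.
Local Open Scope classical_set_scope.
Local Open Scope ring_scope.

Definition is_stern (a : nat -> int) : Prop :=
  a 0%N = 0 /\ a 1%N = 1 /\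
  (forall n : nat, (1 <= n)%N -> a (2 * n)%N = a n) /\
  (forall n : nat, (1 <= n)%N -> a (2 * n + 1)%N = a n + a n.+1).

Definition is_twisted_stern (b : nat -> int) : Prop :=
  b 0%N = 0 /\ b 1%N = 1 /\
  (forall n : nat, (1 <= n)%N -> b (2 * n)%N = - b n) /\
  (forall n : nat, (1 <= n)%N -> b (2 * n + 1)%N = - (b n + b n.+1)).

Definition shifted_series {R : realType} (c : nat -> int) (x : R) : R :=
  limn (fun N : nat => \sum_(n < N) (c n.+1)%:~R * x ^+ n).

Definition approx_solutions {R : realType} (x y m : R) : set (int * int * nat) :=
  [set t | (0 < t.2)%N /\
     Num.max `|x - t.1.1%:~R / t.2%:R| `|y - t.1.2%:~R / t.2%:R|
       < (t.2%:R : R) `^ (- m)].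

Definition sim_approx_exp {R : realType} (x y : R) : \bar R :=
  ereal_sup [set (m%:E) | m in [set m : R | infinite_set (approx_solutions x y m)]].

(* Main.v *)
(* The series satisfy A(z) = (1 + z + z^2) A(z^2) and B(z) = 2 - (1 + z + z^2) B(z^2). Take
   linear forms R0 + R1 A + R2 B with integer polynomial coefficients, of degree about n and
   vanishing at 0 to an order s close to 3n. Substituting z^(2^k) and applying the functional
   equations k times gives integer linear forms in 1, A(a/b), B(a/b) with coefficients of size
   b^(2^k n) and value of size b^(-2^k (s u - n)), u = 1 - lambda. Three forms of each kind are
   independent near 0, so one of them does not vanish at a given rational point (p1/q, p2/q); if
   q b^(-2^k (s u - n)) is small, then the point is at distance at least about
   1/(q b^(2^k n)). Finitely many pairs (n, s) with n between 21 and 42, together with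
   their dilates by 2^k, are dense enough to give the exponent
   1 + (27 + 3 u)/(77 u - 27) = 80 u/(77 u - 27). The forms themselves come from an order basis
   computation over Z. *)
Require Import Defs.
From HB Require Import structures.
From Stdlib Require Import ZArith.
From mathcomp Require Import all_boot all_order all_algebra.
From mathcomp Require Import all_classical all_reals all_analysis.
From mathcomp Require Import ssrZ zify ring lra.
Set Implicit Arguments.
Unset Strict Implicit.
Unset Printing Implicit Defensive.
Import Order.TTheory GRing.Theory Num.Theory.
Import numFieldNormedType.Exports.
Local Open Scope classical_set_scope.
Local Open Scope ring_scope.

(** * The generating functions *)

(** Stern's sequence is the case t = 1 and its twist the case t = -1, so that both series are
    treated at once. *)
Definition twist_rec (t : int) (c : nat -> int) : Prop :=
  [/\ c 0%N = 0, c 1%N = 1,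
      forall n, (0 < n)%N -> c (2 * n)%N = t * c n &
      forall n, (0 < n)%N -> c (2 * n + 1)%N = t * (c n + c n.+1)].

Lemma stern_twist_rec a : is_stern a -> twist_rec 1 a.
Proof.
case=> a0 [a1 [a_even a_odd]]; split=> // n n_gt0.
  by rewrite a_even ?mul1r.
by rewrite a_odd ?mul1r.
Qed.

Lemma twisted_stern_twist_rec b : is_twisted_stern b -> twist_rec (-1) b.
Proof.
case=> b0 [b1 [b_even b_odd]]; split=> // n n_gt0.
  by rewrite b_even ?mulN1r.
by rewrite b_odd ?mulN1r.
Qed.

Lemma twist_rec_bound t c n : twist_rec t c -> `|t| <= 1 -> `|c n| <= n%:Z.
Proof.
case=> c0 c1 c_even c_odd t1.
have [m] := ubnP n; elim: m n => // m IH n.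
have [->|n_gt0] := posnP n; first by rewrite c0.
have [->|n_neq1] := eqVneq n 1%N; first by rewrite c1.
have tM (x y : int) : `|x| <= y -> `|t * x| <= y.
  by move=> xy; rewrite normrM (le_trans _ xy) // ler_piMl.
move=> n_lt; have := odd_double_half n; rewrite -mul2n.
move: n./2 (odd n) => h [] nE; subst n; last first.
  rewrite add0n c_even; last by lia.
  by apply: tM; have := IH h ltac:(lia); lia.
rewrite addnC c_odd; last by lia.
apply: tM; apply: le_trans (ler_normD _ _) _.
have := IH h ltac:(lia); have := IH h.+1 ltac:(lia); lia.
Qed.

Section Series.
Variable R : realType.
Implicit Types (w r : R).

Definition partial_series (c : nat -> int) (w : R) (N : nat) : R :=
  \sum_(n < N) (c n.+1)%:~R * w ^+ n.

(** Differentiated geometric series: in closed form, the partial sum falls short of the limit by a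
    nonnegative term. *)
Lemma sum_natS_geometric_le r N :
  0 <= r -> r < 1 -> \sum_(n < N) n.+1%:R * r ^+ n <= (1 - r) ^- 2.
Proof.
move=> r_ge0 r_lt1.
have sumE : (1 - r) ^+ 2 * (\sum_(n < N) n.+1%:R * r ^+ n)
    = 1 - r ^+ N * (N.+1%:R * (1 - r) + r).
  elim: N => [|N IH]; first by rewrite big_ord0 expr0; ring.
  by rewrite big_ord_recr /= mulrDr IH (exprS r N); ring.
rewrite -[leRHS]mulr1 ler_pdivlMl ?exprn_gt0 ?subr_gt0 //.
rewrite sumE gerBl.
rewrite mulr_ge0 ?exprn_ge0 // addr_ge0 // mulr_ge0 // subr_ge0 ltW //.
Qed.

Variables (t : int) (c : nat -> int).
Hypotheses (c_rec : twist_rec t c) (t_le1 : `|t| <= 1).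

Lemma coef_bound w n : `|(c n.+1)%:~R * w ^+ n| <= n.+1%:R * `|w| ^+ n.
Proof.
rewrite normrM normrX ler_wpM2r ?exprn_ge0 //.
by rewrite -intr_norm -[n.+1%:R]/(n.+1%:Z%:~R) ler_int (twist_rec_bound n.+1 c_rec).
Qed.

(** Since N+i+1 <= (N+1)(i+1), the factor (N+1)|w|^N comes out of the tail. *)
Lemma partial_series_tail w N M : `|w| < 1 -> (N <= M)%N ->
  `|partial_series c w M - partial_series c w N|
    <= N.+1%:R * (1 - `|w|) ^- 2 * `|w| ^+ N.
Proof.
move=> w_lt1 NM; rewrite /partial_series -(subnKC NM) big_split_ord /=.
rewrite addrAC subrr add0r.
apply: le_trans (ler_norm_sum _ _ _) _.
apply: (@le_trans _ _
  (N.+1%:R * `|w| ^+ N * \sum_(i < M - N) i.+1%:R * `|w| ^+ i)); last first.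
  rewrite mulrAC ler_wpM2r ?exprn_ge0 // ler_wpM2l //.
  exact: sum_natS_geometric_le.
rewrite mulr_sumr ler_sum // => i _; apply: le_trans (coef_bound _ _) _.
rewrite exprD mulrACA ler_wpM2r ?mulr_ge0 ?exprn_ge0 //.
by rewrite -natrM ler_nat; lia.
Qed.

Lemma cvg_partial_series w : `|w| < 1 ->
  partial_series c w @ \oo --> shifted_series c w.
Proof.
move=> w_lt1; rewrite /shifted_series.
pose u : R^nat := fun n => (c n.+1)%:~R * w ^+ n.
have -> : partial_series c w = series u.
  by apply/funext => N; rewrite /series /= big_mkord.
rewrite -[X in limn X]/(partial_series c w).
have -> : partial_series c w = series u.
  by apply/funext => N; rewrite /series /= big_mkord.
apply: normed_cvg; apply: nondecreasing_is_cvgn.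
  apply/nondecreasing_seqP => n.
  by rewrite -[leRHS]/(\sum_(0 <= k < n.+1) `|u k|) big_nat_recr //= lerDl.
exists ((1 - `|w|) ^- 2) => _ [N _ <-].
rewrite -[leLHS]/(\sum_(0 <= k < N) `|u k|) big_mkord.
apply: le_trans (sum_natS_geometric_le N (normr_ge0 w) w_lt1).
by rewrite ler_sum // => i _; exact: coef_bound.
Qed.

Lemma shifted_series_tail w N : `|w| < 1 ->
  `|shifted_series c w - partial_series c w N|
    <= N.+1%:R * (1 - `|w|) ^- 2 * `|w| ^+ N.
Proof.
move=> w_lt1.
have cvg_tail : (fun M => `|partial_series c w M - partial_series c w N|) @ \oo
    --> `|shifted_series c w - partial_series c w N|.
  by apply: cvg_norm; apply: cvgB; [exact: cvg_partial_series|exact: cvg_cst].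
apply: (cvgr_to_le cvg_tail); exists N => // M /= NM.
exact: partial_series_tail.
Qed.

(** Terms are grouped by the parity of their index. The constant 1 - t corrects the term of index 0,
    where c_1 = 1 while the odd rule would give t. *)
Lemma partial_series_double w N :
  partial_series c w (2 * N.+1) = (1 - t)%:~R + t%:~R *
    ((1 + w) * partial_series c (w ^+ 2) N.+1 + w ^+ 2 * partial_series c (w ^+ 2) N).
Proof.
case: c_rec => c0 c1 c_even c_odd.
have psS v n : partial_series c v n.+1 = partial_series c v n + (c n.+1)%:~R * v ^+ n.
  by rewrite /partial_series big_ord_recr.
elim: N => [|N IH].
  rewrite /partial_series !big_ord_recr !big_ord0 /= c1 (c_even 1%N) // c1.
  by rewrite !rmorphB /= expr0 expr1 mulr1; ring.
have -> : (2 * N.+2 = (2 * N.+1).+2)%N by lia.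
rewrite 2!(psS w) IH (psS _ N.+1) (psS _ N).
have -> : ((2 * N.+1).+2 = 2 * N.+2)%N by lia.
rewrite -[(2 * N.+1).+1]addn1 c_even // c_odd // addn1.
rewrite -!exprM !rmorphM !rmorphD /= (exprS w (2 * N.+1)).
have -> : (2 * N.+1 = (2 * N).+2)%N by lia.
by rewrite !exprS; ring.
Qed.

Lemma shifted_series_mahler w : `|w| < 1 ->
  shifted_series c w =
    (1 - t)%:~R + t%:~R * ((1 + w + w ^+ 2) * shifted_series c (w ^+ 2)).
Proof.
move=> w_lt1.
have w2_lt1 : `|w ^+ 2| < 1 by rewrite normrX expr_lt1.
have to_infty (f : nat -> nat) : (forall n, n <= f n)%N -> f @ \oo --> \oo.
  move=> f_ge; apply/cvgnyPge => A; exists A => // n /= An.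
  exact: leq_trans An (f_ge n).
have cvg_l : (fun N => partial_series c w (2 * N.+1)) @ \oo --> shifted_series c w.
  have fP : (fun N => 2 * N.+1)%N @ \oo --> \oo by apply: to_infty => n; lia.
  exact: cvg_comp fP (cvg_partial_series w_lt1).
have cvg2 := cvg_partial_series w2_lt1.
have cvg2S : (fun N => partial_series c (w ^+ 2) N.+1) @ \oo
    --> shifted_series c (w ^+ 2).
  exact: cvg_comp (to_infty S leqnSn) cvg2.
apply: (cvg_unique _ cvg_l) => //.
rewrite (_ : (fun N => _) = (fun N => (1 - t)%:~R + t%:~R *
    ((1 + w) * partial_series c (w ^+ 2) N.+1 + w ^+ 2 * partial_series c (w ^+ 2) N)));
  last by apply/funext => N; exact: partial_series_double.
rewrite mulrDl; apply: cvgD; first exact: cvg_cst.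
by apply: cvgMr; apply: cvgD; apply: cvgMr.
Qed.

End Series.

(** * Integer polynomials as coefficient lists *)

(** Lists of binary integers, lowest degree first, let [vm_compute] run the order basis
    algorithm. *)
Fixpoint padd (p q : seq Z) : seq Z :=
  match p, q with
  | [::], _ => q
  | _, [::] => p
  | c :: p', d :: q' => Z.add c d :: padd p' q'
  end.

(* No trailing zeros for c = 0, so that sizes keep bounding degrees. *)
Definition pscale (c : Z) (p : seq Z) : seq Z :=
  if c is Z0 then [::] else [seq Z.mul c d | d <- p].

Fixpoint pmul (p q : seq Z) : seq Z :=
  if p is c :: p' then padd (pscale c q) (Z0 :: pmul p' q) else [::].

(* The pair (c_m, c_(m+1)) for m = p, read off the binary digits of p. *)
Fixpoint twist_pair (t : Z) (p : positive) : Z * Z :=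
  match p with
  | xH => (Zpos xH, t)
  | xO p' => let: (x, y) := twist_pair t p' in (Z.mul t x, Z.mul t (Z.add x y))
  | xI p' => let: (x, y) := twist_pair t p' in (Z.mul t (Z.add x y), Z.mul t y)
  end.

Definition twist_trunc (t : Z) (N : nat) : seq Z :=
  mkseq (fun n => (twist_pair t (Pos.of_succ_nat n)).1) N.

Section Evaluation.
Variable R : realType.
Implicit Types (x w : R) (p q : seq Z).

Definition ZtoR (c : Z) : R := (int_of_Z c)%:~R.

Lemma ZtoRD c d : ZtoR (Z.add c d) = ZtoR c + ZtoR d.
Proof. by rewrite /ZtoR -[Z.add c d]/(c + d) rmorphD /= rmorphD. Qed.

Lemma ZtoRM c d : ZtoR (Z.mul c d) = ZtoR c * ZtoR d.
Proof. by rewrite /ZtoR -[Z.mul c d]/(c * d) rmorphM /= rmorphM. Qed.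

Lemma ZtoR_eq0 c : (ZtoR c == 0) = (Z.eqb c Z0).
Proof. by rewrite /ZtoR intr_eq0; case: c => //= p; lia. Qed.

Definition peval (x : R) (p : seq Z) : R := foldr (fun c y => ZtoR c + x * y) 0 p.

Lemma peval_add x p q : peval x (padd p q) = peval x p + peval x q.
Proof.
elim: p q => [|c p IH] [|d q] /=; rewrite ?add0r ?addr0 //.
by rewrite IH ZtoRD; ring.
Qed.

Lemma peval_scale x c p : peval x (pscale c p) = ZtoR c * peval x p.
Proof.
have mapE : peval x [seq Z.mul c d | d <- p] = ZtoR c * peval x p.
  by elim: p => [|d p IH] /=; rewrite ?mulr0 // IH ZtoRM; ring.
by case: c mapE => // _; rewrite /ZtoR /= mul0r.
Qed.

Lemma peval_mul x p q : peval x (pmul p q) = peval x p * peval x q.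
Proof.
elim: p => [|c p IH] /=; first by rewrite mul0r.
by rewrite peval_add peval_scale /= IH /ZtoR /=; ring.
Qed.

Lemma peval_cat x p q : peval x (p ++ q) = peval x p + x ^+ size p * peval x q.
Proof.
elim: p => [|c p IH] /=; first by rewrite expr0; ring.
by rewrite IH exprS; ring.
Qed.

Lemma peval_all0 x p : all (Z.eqb Z0) p -> peval x p = 0.
Proof.
elim: p => //= -[|c|c] p IH //= /IH ->.
by rewrite /ZtoR /= mulr0 addr0.
Qed.

Definition pnorm p : R := \sum_(c <- p) `|ZtoR c|.

Lemma pnorm_ge0 p : 0 <= pnorm p.
Proof. by rewrite sumr_ge0. Qed.

Lemma peval_norm_le x p : `|x| <= 1 -> `|peval x p| <= pnorm p.
Proof.
move=> x_le1; rewrite /pnorm; elim: p => [|c p IH] /=.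
  by rewrite normr0 big_nil.
rewrite big_cons; apply: le_trans (ler_normD _ _) _; rewrite lerD2l.
by rewrite normrM; apply: le_trans IH; rewrite ler_piMl.
Qed.

(** Each monomial x^i T^n with i <= n equals (xT)^i T^(n-i). *)
Lemma peval_int x T p n : T \is a Num.int -> x * T \is a Num.int ->
  (size p <= n.+1)%N -> peval x p * T ^+ n \is a Num.int.
Proof.
move=> T_int xT_int; elim: p n => [|c p IH] n /=; first by rewrite mul0r rpred0.
have c_int m : ZtoR c * T ^+ m \is a Num.int.
  by rewrite rpredM ?rpredX // intr_int.
rewrite ltnS; case: n => [|n] size_p.
  by move: size_p; rewrite leqn0 => /nilP -> /=; rewrite mulr0 addr0.
rewrite mulrDl rpredD // exprS mulrACA rpredM // IH //.
Qed.

Lemma peval_cvg (w : R^nat) p : w @ \oo --> (0 : R) ->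
  (fun k => peval (w k) p) @ \oo --> ZtoR (head Z0 p).
Proof.
move=> w_cvg; elim: p => [|c p IH] /=; first by rewrite /ZtoR; exact: cvg_cst.
rewrite -[X in _ --> X]addr0; apply: cvgD; first exact: cvg_cst.
rewrite -[X in _ --> X](mul0r (ZtoR (head Z0 p))).
exact: cvgM.
Qed.

Lemma twist_pairP t c (p : positive) : twist_rec t c ->
  twist_pair (Z_of_int t) p =
    (Z_of_int (c (Pos.to_nat p)), Z_of_int (c (Pos.to_nat p).+1)).
Proof.
move=> [c0 c1 c_even c_odd].
have ZD (x y : int) : Z.add (Z_of_int x) (Z_of_int y) = Z_of_int (x + y).
  by rewrite rmorphD.
have ZM (x y : int) : Z.mul (Z_of_int x) (Z_of_int y) = Z_of_int (x * y).
  by rewrite rmorphM.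
elim: p => [p IH|p IH|] /=; last 1 first.
- by rewrite (c_even 1%N) // c1 mulr1.
- have p_gt0 : (0 < Pos.to_nat p)%N by lia.
  have -> : Pos.to_nat p~1 = (2 * Pos.to_nat p + 1)%N by lia.
  have -> : (2 * Pos.to_nat p + 1).+1 = (2 * (Pos.to_nat p).+1)%N by lia.
  by rewrite IH c_odd // c_even // ZD !ZM.
- have p_gt0 : (0 < Pos.to_nat p)%N by lia.
  have -> : Pos.to_nat p~0 = (2 * Pos.to_nat p)%N by lia.
  by rewrite -[X in _ = (_, Z_of_int (c X))]addn1 IH c_odd // c_even // ZD !ZM.
Qed.

Lemma peval_twist_trunc t c w N : twist_rec t c ->
  peval w (twist_trunc (Z_of_int t) N) = partial_series c w N.
Proof.
move=> c_rec; elim: N => [|N IH]; first by rewrite /partial_series big_ord0.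
rewrite /twist_trunc /mkseq -addn1 iotaD map_cat peval_cat IH.
rewrite /partial_series addn1 big_ord_recr /= size_map size_iota.
rewrite (twist_pairP _ c_rec) /= /ZtoR Z_of_intK mulr0 addr0 add0n.
by rewrite SuccNat2Pos.id_succ mulrC.
Qed.

End Evaluation.

(** * Hermite-Pade forms *)

(* The form coef0 + coef1 A + coef2 B; residual lists its power series coefficients from the
   current order on, and weight bounds the degrees of z^2 coef0, coef1, z coef2: with these
   shifts the bound doubles when z is replaced by z^2. Only form_ok below is relied upon. *)
Record form := Form {
  coef0 : seq Z; coef1 : seq Z; coef2 : seq Z; residual : seq Z; weight : nat }.

Definition pshift (p : seq Z) : seq Z := if p is [::] then [::] else Z0 :: p.

(** Multiplication by z raises the order by one; the residual, listed from the order on, stays the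
    same. *)
Definition form_shift f := Form (pshift (coef0 f)) (pshift (coef1 f))
  (pshift (coef2 f)) (residual f) (weight f).+1.

Definition form_primitive f :=
  let g := foldr Z.gcd Z0 (coef0 f ++ coef1 f ++ coef2 f) in
  let d := map (Z.div^~ g) in
  Form (d (coef0 f)) (d (coef1 f)) (d (coef2 f)) (d (residual f)) (weight f).

(** The combination (x/d) g - (y/d) f cancels the leading residual coefficient of g. The weight of g
    is kept because the pivot f is no heavier whenever y is nonzero. *)
Definition form_elim (f g : form) :=
  let x := head Z0 (residual f) in let y := head Z0 (residual g) in
  let d := Z.gcd x y in
  let comb p q := padd (pscale (Z.div x d) p) (pscale (Z.opp (Z.div y d)) q) in
  form_primitive (Form (comb (coef0 g) (coef0 f)) (comb (coef1 g) (coef1 f))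
    (comb (coef2 g) (coef2 f)) (behead (comb (residual g) (residual f))) (weight g)).

(** Sorting puts first the lightest form whose residual head is nonzero; forms that already have
    higher order come last. *)
Definition pivot_le (f g : form) :=
  if head Z0 (residual g) is Z0 then true
  else if head Z0 (residual f) is Z0 then false
  else (weight f <= weight g)%N.

(* One step of the order basis algorithm: raises the order of all three forms by one. *)
Definition basis_step (fs : seq form) : seq form :=
  if sort pivot_le fs is f :: gs then form_shift f :: map (form_elim f) gs else [::].

Definition basis_start (N : nat) : seq form :=
  [:: Form [:: Zpos xH] [::] [::] (Zpos xH :: nseq N Z0) 2;
      Form [::] [:: Zpos xH] [::] (twist_trunc (Zpos xH) N) 0;
      Form [::] [::] [:: Zpos xH] (twist_trunc (Zneg xH) N) 1].

Definition form_series (N : nat) (f : form) : seq Z :=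
  padd (coef0 f) (padd (pmul (twist_trunc (Zpos xH) N) (coef1 f))
                       (pmul (twist_trunc (Zneg xH) N) (coef2 f))).

(** With s+1 terms of each series the coefficient of z^s is exact, so the head of this list is that
    of the true form. *)
Definition form_lead (s : nat) (f : form) : seq Z := drop s (form_series s.+1 f).

Definition det3 (K : comNzRingType) (x y z : K * K * K) : K :=
  let: (x0, x1, x2) := x in let: (y0, y1, y2) := y in let: (z0, z1, z2) := z in
  x0 * (y1 * z2 - y2 * z1) - y0 * (x1 * z2 - x2 * z1) + z0 * (x1 * y2 - x2 * y1).

Definition form_ok (n s : nat) (f : form) : bool :=
  [&& (size (coef0 f) < n)%N, (size (coef1 f) <= n.+1)%N, (size (coef2 f) <= n)%N &
      all (Z.eqb Z0) (take s (form_series s.+1 f))].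

(** A column operation replaces [coef0] by the form itself, divided by z^s; this is the resulting
    row at z = 0. *)
Definition form_heads (s : nat) (f : form) : Z * Z * Z :=
  (head Z0 (form_lead s f), head Z0 (coef1 f), head Z0 (coef2 f)).

Definition level_ok (n s : nat) (fs : seq form) : bool :=
  if fs is [:: f; g; h] then
    [&& form_ok n s f, form_ok n s g, form_ok n s h &
        ~~ Z.eqb (det3 (form_heads s f) (form_heads s g) (form_heads s h)) Z0]
  else false.

(* Pairs (n, s): weight n, order s. *)
Definition levels : seq (nat * nat) :=
  [:: (21, 60); (22, 63); (23, 66); (24, 69); (26, 75); (28, 81); (30, 87);
      (33, 95); (35, 102); (39, 114)]%N.

(** Entry s of the trajectory is the basis after s steps; 115 entries reach the largest order 114,
    and each step consumes at most one of the 120 initial series terms. *)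
Lemma levels_ok : let bases := traject basis_step (basis_start 120) 115 in
  all (fun l => level_ok l.1 l.2 (nth [::] bases l.2)) levels.
Proof. by vm_compute. Qed.

(* A discriminant condition: the quadratic (27 + 3 u) (s u - n) - n' (77 u - 27) in u is
   nowhere negative. *)
Definition level_next (l l' : nat * nat) : bool :=
  let: (n, s) := l in let n' := l'.1 in
  [&& (0 < s)%N, (n <= n')%N, (27 * s <= 77 * n' + 3 * n)%N &
      ((77 * n' + 3 * n - 27 * s) ^ 2 <= 324 * (s * (n' - n)))%N].

(* The last level is followed by twice the first one, which is what one step of the functional
   equations turns it into; hence 42 = 2 * 21. *)
Lemma levels_path : path level_next (21, 60)%N (rcons (behead levels) (42, 0)%N).
Proof. by vm_compute. Qed.

Lemma level_nextP (R : realFieldType) (u : R) l l' : level_next l l' ->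
  l'.1%:R * (77 * u - 27) <= (27 + 3 * u) * (l.2%:R * u - l.1%:R).
Proof.
case: l l' => [n s] [n' s'] /= /and4P[s_gt0 nn' b_ge0 disc].
have {disc} : (77 * n'%:R + 3 * n%:R - 27 * s%:R) ^+ 2 <= 324 * (s%:R * (n'%:R - n%:R)) :> R.
  by rewrite -natrB // -!natrM -natrD -natrB // -natrX ler_nat.
have {s_gt0} : 0 < s%:R :> R by rewrite ltr0n.
move: (s%:R) (n'%:R) (n%:R) => {b_ge0 nn' n s n' s'} s n' n s_gt0 disc.
(* Completing the square: 12 s times the quadratic is this square plus the nonnegative difference of
   the two sides of [disc]. *)
have sq := sqr_ge0 (6 * s * u - (77 * n' + 3 * n - 27 * s)).
rewrite -subr_ge0 -(pmulr_rge0 _ s_gt0).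
nra.
Qed.

(** * Iterating the functional equations *)

Section Iteration.
Variable R : realType.
Implicit Types (z w r T : R).

Fixpoint mahler_prod z k : R :=
  if k is k'.+1 then mahler_prod z k' * (1 + z ^+ (2 ^ k') + z ^+ (2 ^ k') ^+ 2)
  else 1.

(** The constants accumulated by k uses of the functional equation; they vanish for t = 1. *)
Fixpoint mahler_sum (t : int) z k : R :=
  if k is k'.+1 then mahler_sum t z k' + (1 - t)%:~R * t%:~R ^+ k' * mahler_prod z k'
  else 0.

Lemma exp2S z k : z ^+ (2 ^ k.+1) = z ^+ (2 ^ k) ^+ 2.
Proof. by rewrite expnSr exprM. Qed.

Lemma exp_pow2_lt1 z k : `|z| < 1 -> `|z ^+ (2 ^ k)| < 1.
Proof. by move=> z_lt1; rewrite normrX expr_lt1 // expn_gt0. Qed.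

Lemma shifted_series_iter t c z k : twist_rec t c -> `|t| <= 1 -> `|z| < 1 ->
  shifted_series c z =
    mahler_sum t z k + t%:~R ^+ k * mahler_prod z k * shifted_series c (z ^+ (2 ^ k)).
Proof.
move=> c_rec t_le1 z_lt1; elim: k => [|k ->] /=; first by rewrite expr1; ring.
rewrite (shifted_series_mahler c_rec t_le1 (exp_pow2_lt1 k z_lt1)) -exp2S.
by rewrite exprS; ring.
Qed.

Lemma mahler_prod_neq0 z k : mahler_prod z k != 0.
Proof.
elim: k => [|k IH] /=; first exact: oner_neq0.
rewrite mulf_neq0 // gt_eqF //; move: (z ^+ (2 ^ k)) => w.
by have := sqr_ge0 (w + 1 / 2); nra.
Qed.

(** Each factor is at most (1 + h)^2 with h = |z|^(2^j), and (1 - h)(1 + h) = 1 - h^2 telescopes. *)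
Lemma mahler_prod_bound z k : `|z| < 1 -> `|mahler_prod z k| <= (1 - `|z|) ^- 2.
Proof.
move=> z_lt1; rewrite -[leRHS]mulr1 ler_pdivlMl ?exprn_gt0 ?subr_gt0 //.
apply: (@le_trans _ _ ((1 - `|z| ^+ (2 ^ k)) ^+ 2)); last first.
  by rewrite expr_le1 ?gerBl ?exprn_ge0 // subr_ge0 exprn_ile1 // ltW.
elim: k => [|k IH] /=; first by rewrite normr1 mulr1 expr1.
rewrite exp2S normrM mulrA.
apply: (@le_trans _ _ ((1 - `|z| ^+ (2 ^ k)) ^+ 2 * (1 + `|z| ^+ (2 ^ k)) ^+ 2)).
  apply: ler_pM; rewrite ?mulr_ge0 ?exprn_ge0 ?subr_ge0 ?(ltW z_lt1) //.
  rewrite -normrX; move: (z ^+ (2 ^ k)) => w.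
  apply: le_trans (ler_normD _ _) _; rewrite normrX.
  apply: (@le_trans _ _ (1 + `|w| + `|w| ^+ 2)).
    by rewrite lerD2r; apply: le_trans (ler_normD _ _) _; rewrite normr1.
  by have := normr_ge0 w; nra.
move: (`|z| ^+ (2 ^ k)) => h.
by rewrite [leLHS](_ : _ = (1 - h ^+ 2) ^+ 2) //; ring.
Qed.

Section Integrality.
Variables (z T : R).
Hypotheses (T_int : T \is a Num.int) (zT_int : z * T \is a Num.int).

Lemma exp_pow2_int k : z ^+ (2 ^ k) * T ^+ (2 ^ k) \is a Num.int.
Proof. by rewrite -exprMn rpredX. Qed.

(** In z, the product has degree 2^(k+1) - 2, while [mahler_sum] stops one factor earlier, so that
    T^(2^k) suffices for it. *)
Lemma mahler_prod_int k : mahler_prod z k * T ^+ (2 ^ k) ^+ 2 \is a Num.int.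
Proof.
elim: k => [|k IH] /=; first by rewrite mul1r !rpredX.
rewrite exp2S -exprM [X in X \is a _](_ : _ =
  mahler_prod z k * T ^+ (2 ^ k) ^+ 2 *
  (T ^+ (2 ^ k) ^+ 2 + z ^+ (2 ^ k) * T ^+ (2 ^ k) * T ^+ (2 ^ k)
   + (z ^+ (2 ^ k) * T ^+ (2 ^ k)) ^+ 2)); last by rewrite exprM; ring.
have zk_int := exp_pow2_int k; have Tk_int := rpredX (2 ^ k) T_int.
by apply: rpredM => //; rewrite rpredD ?rpredX // rpredD ?rpredX // rpredM.
Qed.

Lemma mahler_sum_int t k : mahler_sum t z k * T ^+ (2 ^ k) \is a Num.int.
Proof.
elim: k => [|k IH] /=; first by rewrite mul0r rpred0.
rewrite exp2S mulrDl rpredD //; first by rewrite expr2 mulrA rpredM ?rpredX.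
rewrite -(mulrA (_ * _) (mahler_prod z k)); apply: rpredM; last exact: mahler_prod_int.
by apply: rpredM; [exact: intr_int|apply: rpredX; exact: intr_int].
Qed.

End Integrality.

Lemma pow2_cvg0 z : `|z| < 1 -> (fun k => z ^+ (2 ^ k)) @ \oo --> (0 : R).
Proof.
move=> z_lt1.
have pow2_infty : (fun k => 2 ^ k)%N @ \oo --> \oo.
  apply/cvgnyPge => N; exists N => // k /= Nk.
  by apply: leq_trans Nk _; rewrite ltnW // ltn_expl.
exact: cvg_comp pow2_infty (cvg_expr z_lt1).
Qed.

End Iteration.

(** * Lower bounds from the three forms of one level *)

Section LevelForms.
Variables (R : realType) (a b : nat -> int).
Hypotheses (a_rec : twist_rec 1 a) (b_rec : twist_rec (-1) b).
Implicit Types (z w : R) (f : form).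
Let A : R -> R := shifted_series a.
Let B : R -> R := shifted_series b.

Lemma peval_form_series w N f : peval w (form_series N f) =
  peval w (coef0 f) + partial_series a w N * peval w (coef1 f)
    + partial_series b w N * peval w (coef2 f).
Proof.
rewrite /form_series !peval_add !peval_mul addrA.
by rewrite (peval_twist_trunc w N a_rec) (peval_twist_trunc w N b_rec).
Qed.

Lemma peval_form_lead n s f w : form_ok n s f ->
  peval w (form_series s.+1 f) = w ^+ s * peval w (form_lead s f).
Proof.
case/and4P=> _ _ _ order_f; rewrite /form_lead -[in LHS](cat_take_drop s (form_series _ f)).
rewrite peval_cat peval_all0 // add0r size_take.
by case: ltnP => // ?; rewrite drop_oversize //= !mulr0.
Qed.

(** Truncating both series after s+1 terms leaves w^s times the lead, and the tails are O(|w|^(s+1))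
    uniformly for |w| <= r. *)
Lemma form_remainder n s f r : form_ok n s f -> r < 1 ->
  exists C : R, forall w, `|w| <= r ->
    `|peval w (coef0 f) + peval w (coef1 f) * A w + peval w (coef2 f) * B w|
      <= C * `|w| ^+ s.
Proof.
move=> f_ok r_lt1.
pose K : R := s.+2%:R * (1 - r) ^- 2.
exists (pnorm R (form_lead s f) + pnorm R (coef1 f) * K + pnorm R (coef2 f) * K) => w w_le.
have w_lt1 : `|w| < 1 := le_lt_trans w_le r_lt1.
have tail t c : twist_rec t c -> `|t| <= 1 ->
    `|shifted_series c w - partial_series c w s.+1| <= K * `|w| ^+ s.
  move=> c_rec t_le1; apply: le_trans (shifted_series_tail c_rec t_le1 _ w_lt1) _.
  rewrite (exprSr `|w|) mulrA; apply: le_trans (ler_piMr _ (ltW w_lt1)) _.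
    by rewrite !mulr_ge0 ?exprn_ge0 ?invr_ge0 ?exprn_ge0 // subr_ge0 ltW.
  rewrite ler_wpM2r ?exprn_ge0 // ler_wpM2l // lef_pV2 ?posrE ?exprn_gt0 ?subr_gt0 //.
  by rewrite lerXn2r ?nnegrE ?subr_ge0 ?(ltW r_lt1) ?(ltW w_lt1) // lerB.
have -> : peval w (coef0 f) + peval w (coef1 f) * A w + peval w (coef2 f) * B w =
    w ^+ s * peval w (form_lead s f)
    + peval w (coef1 f) * (A w - partial_series a w s.+1)
    + peval w (coef2 f) * (B w - partial_series b w s.+1).
  by rewrite -(peval_form_lead w f_ok) peval_form_series; ring.
rewrite !mulrDl; apply: le_trans (ler_normD _ _) _; apply: lerD.
  apply: le_trans (ler_normD _ _) _; apply: lerD.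
    by rewrite normrM normrX mulrC ler_wpM2r ?exprn_ge0 // peval_norm_le // ltW.
  by rewrite normrM -mulrA ler_pM // ?peval_norm_le ?(ltW w_lt1) // (tail 1).
by rewrite normrM -mulrA ler_pM // ?peval_norm_le ?(ltW w_lt1) // (tail (-1)).
Qed.

(* The form f at z^(2^k), rewritten by the functional equations as a form in A z and B z and
   evaluated at (v0, v1, v2) in place of (1, A z, B z). *)
Definition iter_form z k f (v0 v1 v2 : R) : R :=
  let w := z ^+ (2 ^ k) in
  mahler_prod z k * peval w (coef0 f) * v0 + peval w (coef1 f) * v1
    + (-1) ^+ k * peval w (coef2 f) * (v2 - mahler_sum (-1) z k * v0).

Section Point.
Variables (z T : R).
Hypotheses (T_int : T \is a Num.int) (zT_int : z * T \is a Num.int).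
Hypothesis z_lt1 : `|z| < 1.

(** This is where the degree shifts pay off: with U = T^(2^k), the bounds n-2 and n-1 leave U^2 for
    [mahler_prod] and U for [mahler_sum]. *)
Lemma iter_form_int n s f k v0 v1 v2 : form_ok n s f ->
  v0 \is a Num.int -> v1 \is a Num.int -> v2 \is a Num.int ->
  iter_form z k f v0 v1 v2 * T ^+ (2 ^ k) ^+ n \is a Num.int.
Proof.
case/and4P=> size0 size1 size2 _ v0_int v1_int v2_int; rewrite /iter_form.
have Tk_int : T ^+ (2 ^ k) \is a Num.int by rewrite rpredX.
have zk_int := exp_pow2_int zT_int k.
have pi_int := mahler_prod_int T_int zT_int k.
have sum_int := mahler_sum_int T_int zT_int (-1) k.
have sgn_int : ((-1) ^+ k : R) \is a Num.int by rewrite rpredX // rpredN1.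
move: (z ^+ (2 ^ k)) (T ^+ (2 ^ k)) (mahler_prod z k) (mahler_sum _ z k) ((-1) ^+ k)
  Tk_int zk_int pi_int sum_int sgn_int => w U p q e U_int wU_int pU_int qU_int e_int.
have P1_int : peval w (coef1 f) * U ^+ n \is a Num.int by exact: peval_int.
rewrite 2!mulrDl rpredD //.
  rewrite rpredD //; last by rewrite mulrAC rpredM.
  (* An empty [coef0] is set apart: n may then be 1, where truncated subtraction breaks n = (n-2) +
     2. *)
  case: (posnP (size (coef0 f))) => [/size0nil ->|size0_gt0].
    by rewrite /= mulr0 !mul0r rpred0.
  have n_ge2 : (n = n.-2 + 2)%N by clear -size0 size0_gt0; lia.
  have P0_int : peval w (coef0 f) * U ^+ n.-2 \is a Num.int by apply: peval_int => //; clear -size0 size0_gt0; lia.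
  rewrite n_ge2 exprD [X in X \in _](_ : _ = (p * U ^+ 2) *
    (peval w (coef0 f) * U ^+ n.-2) * v0); last by ring.
  by rewrite rpredM // rpredM.
case: (posnP (size (coef2 f))) => [/size0nil ->|size2_gt0].
  by rewrite /= mulr0 !mul0r rpred0.
have n_ge1 : (n = n.-1 + 1)%N by clear -size2 size2_gt0; lia.
have P2_int : peval w (coef2 f) * U ^+ n.-1 \is a Num.int by apply: peval_int => //; clear -size2 size2_gt0; lia.
rewrite n_ge1 exprD expr1 [X in X \in _](_ : _ = e * (peval w (coef2 f) * U ^+ n.-1) *
  (v2 * U - (q * U) * v0)); last by ring.
by apply: rpredM; [exact: rpredM|apply: rpredB; exact: rpredM].
Qed.

(** At v0 (1, A z, B z) the iterated form is v0 [mahler_prod] times the original form at z^(2^k),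
    hence small; the rest is linear in the approximation errors. *)
Lemma iter_form_bound n s f : form_ok n s f -> exists C : R, forall k v0 v1 v2,
  `|iter_form z k f v0 v1 v2| <=
    C * (`|v0| * `|z ^+ (2 ^ k)| ^+ s + `|v0 * A z - v1| + `|v0 * B z - v2|).
Proof.
move=> f_ok; have [C0 remainder] := form_remainder f_ok z_lt1.
pose K : R := (1 - `|z|) ^- 2.
exists (K * `|C0| + pnorm R (coef1 f) + pnorm R (coef2 f)) => k v0 v1 v2.
have w_le : `|z ^+ (2 ^ k)| <= `|z|.
  by rewrite normrX -[leRHS]expr1 ler_wiXn2l ?(ltW z_lt1) // expn_gt0.
have w_le1 := le_trans w_le (ltW z_lt1).
have -> : iter_form z k f v0 v1 v2 =
    v0 * (mahler_prod z k * (peval (z ^+ (2 ^ k)) (coef0 f)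
      + peval (z ^+ (2 ^ k)) (coef1 f) * A (z ^+ (2 ^ k))
      + peval (z ^+ (2 ^ k)) (coef2 f) * B (z ^+ (2 ^ k))))
    - peval (z ^+ (2 ^ k)) (coef1 f) * (v0 * A z - v1)
    - (-1) ^+ k * peval (z ^+ (2 ^ k)) (coef2 f) * (v0 * B z - v2).
  have sum0 : mahler_sum 1 z k = 0.
    by elim: (k) => //= j ->; rewrite subrr !mul0r addr0.
  have sgn2 : (-1) ^+ k * (-1) ^+ k = 1 :> R by rewrite -exprMn mulrNN mulr1 expr1n.
  have := shifted_series_iter k a_rec (lexx _) z_lt1; rewrite sum0 expr1n add0r mul1r.
  have := shifted_series_iter k b_rec (lexx _) z_lt1; rewrite rmorphN1.
  rewrite /iter_form /A /B => -> ->.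
  move: sgn2; set e := (-1) ^+ k => sgn2; clearbody e.
  by ring: sgn2.
have pi_le := mahler_prod_bound k z_lt1.
have rem := remainder _ w_le.
have n1 := pnorm_ge0 R (coef1 f); have n2 := pnorm_ge0 R (coef2 f).
have K_ge0 : 0 <= K := le_trans (normr_ge0 _) pi_le.
set X := `|v0| * _; set Y := `|_ - v1|; set W := `|_ - v2|.
have X_ge0 : 0 <= X by rewrite mulr_ge0 ?exprn_ge0.
have Y_ge0 : 0 <= Y := normr_ge0 _.
have W_ge0 : 0 <= W := normr_ge0 _.
apply: (@le_trans _ _ (K * `|C0| * X + pnorm R (coef1 f) * Y + pnorm R (coef2 f) * W)).
  apply: le_trans (ler_normB _ _) _; apply: lerD; last first.
    by rewrite 2!normrM normrX normrN1 expr1n mul1r ler_wpM2r // peval_norm_le.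
  apply: le_trans (ler_normB _ _) _; apply: lerD; last first.
    by rewrite normrM ler_wpM2r // peval_norm_le.
  rewrite normrM mulrCA ler_wpM2l // normrM -mulrA ler_pM //.
  by apply: le_trans rem _; rewrite ler_wpM2r ?exprn_ge0 // ler_norm.
have KC : 0 <= K * `|C0| by rewrite mulr_ge0.
by nra.
Qed.

End Point.

Lemma det3_kernel (K : comNzRingType) (x y z : K * K * K) (v0 v1 v2 : K) :
  x.1.1 * v0 + x.1.2 * v1 + x.2 * v2 = 0 ->
  y.1.1 * v0 + y.1.2 * v1 + y.2 * v2 = 0 ->
  z.1.1 * v0 + z.1.2 * v1 + z.2 * v2 = 0 -> det3 x y z * v0 = 0.
Proof.
case: x y z => [[x0 x1] x2] [[y0 y1] y2] [[z0 z1] z2] /= Ex Ey Ez.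
rewrite [LHS](_ : _ = (y1 * z2 - y2 * z1) * (x0 * v0 + x1 * v1 + x2 * v2)
  - (x1 * z2 - x2 * z1) * (y0 * v0 + y1 * v1 + y2 * v2)
  + (x1 * y2 - x2 * y1) * (z0 * v0 + z1 * v1 + z2 * v2)); last by ring.
by rewrite Ex Ey Ez; ring.
Qed.

Definition form_vec (s : nat) (f : form) (w : R) : R * R * R :=
  (peval w (form_lead s f), peval w (coef1 f), peval w (coef2 f)).

Lemma form_det_cvg s f g h (w : R^nat) : w @ \oo --> (0 : R) ->
  (fun k => det3 (form_vec s f (w k)) (form_vec s g (w k)) (form_vec s h (w k))) @ \oo -->
  ZtoR R (det3 (form_heads s f) (form_heads s g) (form_heads s h)).
Proof.
move=> w_cvg; have ev p := @peval_cvg R w p w_cvg.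
rewrite /det3 /form_heads.
have ZD c d : ZtoR R (c + d) = ZtoR R c + ZtoR R d by exact: ZtoRD.
have ZM c d : ZtoR R (c * d) = ZtoR R c * ZtoR R d by exact: ZtoRM.
have ZN c : ZtoR R (- c) = - ZtoR R c by rewrite /ZtoR !rmorphN.
rewrite !(ZD, ZN, ZM).
have term p q q' r r' := cvgM (ev p) (cvgB (cvgM (ev q) (ev q')) (cvgM (ev r) (ev r'))).
apply: cvgD; [apply: cvgB|]; exact: term.
Qed.

(** The column operation with truncated series turns a zero of the form into a kernel relation for
    [form_vec], whose first coordinate is nonzero once z and v0 are. *)
Lemma iter_form_kernel n s f z k v0 v1 v2 (w := z ^+ (2 ^ k)) : form_ok n s f ->
  iter_form z k f v0 v1 v2 = 0 ->
  let V0 := mahler_prod z k * v0 in let x := form_vec s f w in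
  x.1.1 * (w ^+ s * V0) + x.1.2 * (v1 - partial_series a w s.+1 * V0)
    + x.2 * ((-1) ^+ k * (v2 - mahler_sum (-1) z k * v0) - partial_series b w s.+1 * V0) = 0.
Proof.
move=> f_ok form0 /=; have := peval_form_lead w f_ok; rewrite peval_form_series => lead.
rewrite mulrCA [X in X + _ + _](_ : _ = w ^+ s * peval w (form_lead s f) *
  (mahler_prod z k * v0)); last by ring.
by rewrite -lead -form0 /iter_form -/w; ring.
Qed.

(** For large k the determinant of the [form_vec] rows is near its nonzero limit, so some form does
    not vanish at the point. Cleared of denominators it is a nonzero integer, of size at least 1. *)
Lemma level_bound n s fs z T : level_ok n s fs ->
  T \is a Num.int -> z * T \is a Num.int -> `|z| < 1 -> z != 0 -> 1 <= T ->
  exists2 C : R, 0 < C & exists K : nat, forall k v0 v1 v2, (K <= k)%N ->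
    v0 \is a Num.int -> v1 \is a Num.int -> v2 \is a Num.int -> v0 != 0 ->
    1 <= C * T ^+ (2 ^ k) ^+ n *
      (`|v0| * `|z ^+ (2 ^ k)| ^+ s + `|v0 * A z - v1| + `|v0 * B z - v2|).
Proof.
case: fs => [|f [|g [|h []]]] // /and4P[f_ok g_ok h_ok det_neq0].
move=> T_int zT_int z_lt1 z_neq0 T_ge1.
have [Cf bf] := iter_form_bound z_lt1 f_ok.
have [Cg bg] := iter_form_bound z_lt1 g_ok.
have [Ch bh] := iter_form_bound z_lt1 h_ok.
pose C := 1 + `|Cf| + `|Cg| + `|Ch|; exists C.
  by rewrite /C -!addrA ltr_pwDl // !addr_ge0.
have det_lim := @form_det_cvg s f g h _ (pow2_cvg0 z_lt1).
rewrite -(ZtoR_eq0 R) in det_neq0.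
have [K _ det_k] := cvgr_neq0 _ det_lim det_neq0.
exists K => k v0 v1 v2 /det_k {}det_k v0_int v1_int v2_int v0_neq0.
have T_ge0 : 0 <= T ^+ (2 ^ k) ^+ n by rewrite !exprn_ge0 // (le_trans ler01).
have from_form e D : form_ok n s e -> `|D| <= C -> (forall k v0 v1 v2,
    `|iter_form z k e v0 v1 v2| <=
    D * (`|v0| * `|z ^+ (2 ^ k)| ^+ s + `|v0 * A z - v1| + `|v0 * B z - v2|)) ->
    iter_form z k e v0 v1 v2 != 0 -> 1 <= C * T ^+ (2 ^ k) ^+ n *
      (`|v0| * `|z ^+ (2 ^ k)| ^+ s + `|v0 * A z - v1| + `|v0 * B z - v2|).
  move=> e_ok DC be e_neq0.
  have e_int := iter_form_int T_int zT_int k e_ok v0_int v1_int v2_int.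
  have Tn0 : T ^+ (2 ^ k) ^+ n != 0 by rewrite !expf_neq0 // gt_eqF // (lt_le_trans ltr01).
  apply: le_trans (norm_intr_ge1 e_int _) _; first by rewrite mulf_neq0.
  rewrite normrM (ger0_norm T_ge0) mulrAC ler_wpM2r //.
  apply: le_trans (be _ _ _ _) _; rewrite ler_wpM2r ?addr_ge0 ?mulr_ge0 ?exprn_ge0 //.
  exact: le_trans (ler_norm _) DC.
have nf := normr_ge0 Cf; have ng := normr_ge0 Cg; have nh := normr_ge0 Ch.
have [f0|/(from_form _ _ f_ok _ bf)] := eqVneq (iter_form z k f v0 v1 v2) 0; last first.
  by apply; rewrite /C; lra.
have [g0|/(from_form _ _ g_ok _ bg)] := eqVneq (iter_form z k g v0 v1 v2) 0; last first.
  by apply; rewrite /C; lra.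
have [h0|/(from_form _ _ h_ok _ bh)] := eqVneq (iter_form z k h v0 v1 v2) 0; last first.
  by apply; rewrite /C; lra.
have /eqP := det3_kernel (iter_form_kernel f_ok f0) (iter_form_kernel g_ok g0)
  (iter_form_kernel h_ok h0).
rewrite !mulf_eq0 (negPf det_k) !expf_eq0 (negPf z_neq0) !andbF.
by rewrite (negPf (mahler_prod_neq0 z k)) (negPf v0_neq0).
Qed.

End LevelForms.

(** * From linear forms to the exponent *)

Section Exponent.
Variable R : realType.

Lemma finite_approx_box (N : nat) (X : set (int * int * nat)) :
  (forall t, X t -> [/\ (`|t.1.1| <= N%:Z), (`|t.1.2| <= N%:Z) & (t.2 <= N)%N]) ->
  finite_set X.
Proof.
move=> X_box; pose I : set int := [set Posz k - N%:Z | k in `I_(N + N).+1].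
have finI : finite_set I by apply: finite_image; exact: finite_II.
have inI (p : int) : `|p| <= N%:Z -> I p.
  by move=> pN; exists `|(p + N%:Z)%R|%N => /=; lia.
apply: (sub_finite_set _ (finite_setX (finite_setX finI finI) (finite_II N.+1))).
by move=> [[p1 p2] q] /X_box[/= p1N p2N qN]; split => //; split; exact: inI.
Qed.

(** For m > 1 + e, a solution with large q gives 1 <= 2C q^(1+e-m), which bounds q and then the
    numerators. *)
Lemma sim_approx_exp_le (x y e C Y0 : R) : 0 <= e -> 0 < C ->
  (forall (p1 p2 : int) (q : nat), (0 < q)%N -> Y0 <= ln (q%:R : R) ->
     1 <= C * expR (e * ln q%:R) * (`|q%:R * x - p1%:~R| + `|q%:R * y - p2%:~R|)) ->
  (sim_approx_exp x y <= (1 + e)%:E)%E.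
Proof.
move=> e_ge0 C_gt0 lower; apply: ge_ereal_sup => _ [m m_inf <-].
rewrite lee_fin leNgt; apply/negP => m_gt; apply: m_inf.
pose Y1 := Num.max Y0 (ln (2 * C) / (m - (1 + e))).
(* M bounds q, and each numerator is at most q times |x| or |y|, plus an error of at most 1. *)
pose M := expR Y1; pose N := Num.trunc (M * (`|x| + `|y| + 1)).
have M_ge0 : 0 <= M := expR_ge0 _.
have bound_le (v : R) : v <= M * (`|x| + `|y| + 1) -> v <= N.+1%:R.
  by move=> /le_trans; apply; rewrite ltW // truncnS_gt.
apply: (@finite_approx_box N.+1) => -[[p1 p2] q] [/= q_gt0 approx].
have qR_gt0 : 0 < q%:R :> R by rewrite ltr0n.
have qR_ge1 : 1 <= q%:R :> R by rewrite ler1n.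
have powE : (q%:R : R) `^ (- m) = expR (- m * ln q%:R) by rewrite /powR gt_eqF.
rewrite gt_max powE in approx.
have [approx1 approx2] := andP approx.
have scale (v : R) (p : int) : `|v - p%:~R / q%:R| < expR (- m * ln q%:R) ->
    `|q%:R * v - p%:~R| < expR (ln q%:R - m * ln q%:R).
  move=> v_lt; rewrite expRD lnK ?posrE // -mulNr.
  rewrite [X in `|X|](_ : _ = q%:R * (v - p%:~R / q%:R)); last by field; rewrite gt_eqF.
  by rewrite normrM gtr0_norm // ltr_pM2l.
have q_le : q%:R <= M.
  rewrite -[q%:R]lnK ?posrE // ler_expR le_max.
  have [/ltW ->//|Y0_le] := ltrP (ln q%:R) Y0; apply/orP; right.
  rewrite ler_pdivlMr ?subr_gt0 // -ler_expR (lnK (x := 2 * C)) ?posrE ?mulr_gt0 //.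
  have := lower p1 p2 q q_gt0 Y0_le => low.
  have up : `|q%:R * x - p1%:~R| + `|q%:R * y - p2%:~R|
      <= 2 * expR (ln q%:R - m * ln q%:R).
    by rewrite [leRHS]mulr_natl mulr2n; apply: lerD; apply/ltW/scale.
  have CE_ge0 : 0 <= C * expR (e * ln q%:R) by rewrite mulr_ge0 ?expR_ge0 // ltW.
  have := le_trans low (ler_wpM2l CE_ge0 up).
  rewrite mulrACA (mulrC C) -expRD => low2.
  rewrite -[leLHS]mul1r; apply: le_trans (ler_wpM2r (expR_ge0 _) low2) _.
  rewrite -mulrA -expRD [X in expR X](_ : _ = 0) ?expR0 ?mulr1 //.
  by ring.
have p_le (v : R) (p : int) : `|v| <= `|x| + `|y| ->
    `|v - p%:~R / q%:R| < expR (- m * ln q%:R) -> `|p| <= N.+1%:Z.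
  move=> v_le /scale v_lt.
  rewrite -(ler_int R) intr_norm; apply: bound_le.
  have small : expR (ln q%:R - m * ln q%:R) <= 1.
    rewrite expR_le1 -[X in X - _]mul1r -mulrBl mulr_le0_ge0 ?ln_ge0 // subr_le0 ltW //.
    by apply: le_lt_trans m_gt; rewrite lerDl.
  have := ler_normB (q%:R * v) (q%:R * v - p%:~R); rewrite subKr => p_le.
  apply: le_trans p_le _.
  rewrite normrM gtr0_norm //.
  have nv := normr_ge0 v; nra.
split; first by apply: p_le approx1; rewrite lerDl.
  by apply: p_le approx2; rewrite lerDr.
rewrite -(ler_nat R); apply: bound_le.
by have nx := normr_ge0 x; have ny := normr_ge0 y; nra.
Qed.

Lemma path_last_fail (T : eqType) (r : rel T) (P : pred T) (x : T) (p : seq T) :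
  path r x p -> ~~ P x ->
  (exists y z, [/\ y \in x :: p, z \in p, r y z, ~~ P y & P z]) \/ ~~ P (last x p).
Proof.
elim: p x => [|z p IH] x /=; first by right.
case/andP=> r_xz path_p Px; case: (boolP (P z)) => Pz.
  by left; exists x, z; rewrite !mem_head.
case: (IH z path_p Pz) => [[y [y' [y_in y'_in r_yy' Py Py']]]|]; last by right.
by left; exists y, y'; split; rewrite // in_cons ?y_in ?y'_in orbT.
Qed.

(** Order the dilated levels by k, then along [levels], and take one that reaches Y just after one
    that does not: [level_next] bounds its cost by the insufficient gain of its predecessor. *)
Lemma choose_level (u l Y : R) (K : nat) : 27 / 77 < u -> 0 < l ->
  2 ^+ K * (60 * u - 21) * l < Y ->
  exists k (lv : nat * nat), [/\ (K <= k)%N, lv \in levels,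
    Y <= 2 ^+ k * (lv.2%:R * u - lv.1%:R) * l &
    2 ^+ k * lv.1%:R * l <= (27 + 3 * u) / (77 * u - 27) * Y].
Proof.
move=> u_gt l_gt0 Y_gt.
have den_gt0 : 0 < 77 * u - 27 by rewrite subr_gt0; lra.
pose ok k (lv : nat * nat) := Y <= 2 ^+ k * (lv.2%:R * u - lv.1%:R) * l.
have next k lv (n : R) : n * (77 * u - 27) <= (27 + 3 * u) * (lv.2%:R * u - lv.1%:R) ->
    ~~ ok k lv -> 2 ^+ k * n * l <= (27 + 3 * u) / (77 * u - 27) * Y.
  move=> n_le; rewrite /ok -ltNge => /ltW lv_lt.
  apply: (@le_trans _ _ ((27 + 3 * u) / (77 * u - 27) *
    (2 ^+ k * (lv.2%:R * u - lv.1%:R) * l))); last first.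
    rewrite ler_wpM2l // divr_ge0 ?(ltW den_gt0) //; lra.
  have -> : 2 ^+ k * n * l = 2 ^+ k * l * n by ring.
  have -> : (27 + 3 * u) / (77 * u - 27) * (2 ^+ k * (lv.2%:R * u - lv.1%:R) * l) =
     2 ^+ k * l * ((27 + 3 * u) * (lv.2%:R * u - lv.1%:R) / (77 * u - 27)).
    by field; rewrite gt_eqF.
  by rewrite ler_wpM2l ?mulr_ge0 ?exprn_ge0 ?(ltW l_gt0) // ler_pdivlMr.
have ex_ok : exists k, (K <= k)%N && ok k (21, 60)%N.
  pose e := (60 * u - 21) * l.
  have e_gt0 : 0 < e by rewrite mulr_gt0 // subr_gt0; lra.
  exists (maxn K (Num.bound (`|Y| / e))); rewrite leq_maxl /= /ok /= -mulrA.
  set k := maxn _ _.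
  apply: le_trans (ler_norm Y) _; rewrite -/e -ler_pdivrMr //.
  apply: le_trans (ltW (archi_boundP _)) _; first by rewrite divr_ge0 // ltW.
  rewrite -natrX ler_nat; apply: (@leq_trans k); first exact: leq_maxr.
  by rewrite ltnW // ltn_expl.
(* The lower bound on Y excludes k0 = K, so scale k0 - 1 is still admissible and its first level
   falls short. *)
case: (ex_minnP ex_ok) => k0 /andP[K_le ok_k0] k0_min.
have [k k0E] : exists k, k0 = k.+1.
  case: k0 K_le ok_k0 {k0_min} => [|k] K_le ok_k0; last by exists k.
  move: K_le ok_k0 Y_gt; rewrite leqn0 => /eqP ->.
  by rewrite /ok /= => Y_le /lt_le_trans /(_ Y_le); rewrite ltxx.
have K_le_k : (K <= k)%N.
  move: K_le ok_k0; rewrite k0E leq_eqVlt => /predU1P[KE|//].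
  by rewrite -KE /ok /= => /(lt_le_trans Y_gt); rewrite ltxx.
have not_ok : ~~ ok k (21, 60)%N.
  apply/negP => ok_k; have := k0_min k; rewrite K_le_k ok_k k0E => /(_ isT).
  by rewrite ltnn.
have := levels_path; rewrite rcons_path => /andP[path_lv last_lv].
have levelsE : levels = (21, 60)%N :: behead levels by [].
case: (path_last_fail path_lv not_ok) => [[y [z [_ z_in yz not_y ok_z]]]|not_last].
  exists k, z; split; [exact: K_le_k| |exact: ok_z|].
    by rewrite levelsE in_cons z_in orbT.
  exact: next (level_nextP u yz) not_y.
(* All levels at scale k fall short; the next one is the first level at scale k+1, that is, weight
   42 at scale k. *)
exists k.+1, (21, 60)%N; rewrite -k0E.
split; [exact: K_le|by rewrite levelsE mem_head|exact: ok_k0|].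
apply: le_trans (next _ _ _ (level_nextP u last_lv) not_last).
rewrite k0E exprS [(42, 0).1]/= (natrM R 2 21); clear.
by rewrite [leLHS](_ : _ = 2 ^+ k * (2%:R * 21%:R) * l) //=; ring.
Qed.

End Exponent.

(** * The exponent at a/b *)

Section Bound.
Variables (R : realType) (a b : nat -> int).
Hypotheses (a_rec : twist_rec 1 a) (b_rec : twist_rec (-1) b).

Lemma levels_bound (z T : R) : T \is a Num.int -> z * T \is a Num.int -> `|z| < 1 ->
  z != 0 -> 1 <= T ->
  exists C : R, 0 < C /\ exists K : nat, forall lv k v0 v1 v2, lv \in levels -> (K <= k)%N ->
    v0 \is a Num.int -> v1 \is a Num.int -> v2 \is a Num.int -> v0 != 0 ->
    1 <= C * T ^+ (2 ^ k) ^+ lv.1 * (`|v0| * `|z ^+ (2 ^ k)| ^+ lv.2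
      + `|v0 * shifted_series a z - v1| + `|v0 * shifted_series b z - v2|).
Proof.
move=> T_int zT_int z_lt1 z_neq0 T_ge1.
have := allP levels_ok; move: (traject _ _ _) levels => bases.
elim=> [|l ls IH] lv_ok; first by exists 1; split=> //; exists 0%N.
have /IH[C [C_gt0 [K bound]]] : {in ls, forall l', level_ok l'.1 l'.2 (nth [::] bases l'.2)}.
  by move=> l' l'_in; apply: lv_ok; rewrite in_cons l'_in orbT.
have l_ok := lv_ok l (mem_head _ _).
have [C' C'_gt0 [K' bound']] :=
  level_bound a_rec b_rec l_ok T_int zT_int z_lt1 z_neq0 T_ge1.
have mono (D D' X Y : R) : D <= D' -> 0 <= X -> 0 <= Y -> 1 <= D * X * Y ->
    1 <= D' * X * Y.
  by move=> DD' X_ge0 Y_ge0 /le_trans; apply; rewrite !ler_wpM2r.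
exists (C + C'); split; first exact: addr_gt0.
exists (maxn K K') => lv k v0 v1 v2 lv_in; rewrite geq_max => /andP[Kk K'k] i0 i1 i2 v0_neq0.
have X_ge0 : 0 <= T ^+ (2 ^ k) ^+ lv.1 by rewrite !exprn_ge0 // (le_trans ler01).
move: lv_in; rewrite in_cons => /predU1P[lvE|lv_in].
  subst lv; apply: (mono _ _ _ _ _ _ _ (bound' k v0 v1 v2 K'k i0 i1 i2 v0_neq0)) => //.
  by rewrite lerDr ltW.
apply: (mono _ _ _ _ _ _ _ (bound lv k v0 v1 v2 lv_in Kk i0 i1 i2 v0_neq0)) => //.
by rewrite lerDl ltW.
Qed.

(** Here T = b and |z| = b^(-u). The chosen level makes the term in q at most 1/2, so the
    approximation errors account for the other half. *)
Lemma sim_approx_exp_stern_le (aa : int) (bb : nat) (lam : R) :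
  (2 <= bb)%N -> aa != 0 -> ln (`|aa|%:~R : R) = lam * ln (bb%:R : R) ->
  0 <= lam -> lam < 50 / 77 ->
  (sim_approx_exp (shifted_series a (aa%:~R / bb%:R : R))
                  (shifted_series b (aa%:~R / bb%:R : R))
     <= (80 * (1 - lam) / (50 - 77 * lam))%:E)%E.
Proof.
move=> bb_ge2 aa_neq0 aaE lam_ge0 lam_lt.
set z : R := aa%:~R / bb%:R; set l : R := ln bb%:R in aaE *; pose u := 1 - lam.
have bb_gt0 : 0 < bb%:R :> R by rewrite ltr0n; apply: leq_trans bb_ge2.
have bb_ge1 : 1 <= bb%:R :> R by rewrite ler1n; apply: leq_trans bb_ge2.
have l_gt0 : 0 < l by rewrite ln_gt0 // ltr1n.
have aa_norm_gt0 : 0 < `|aa|%:~R :> R by rewrite ltr0z normr_gt0.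
have u_gt : 27 / 77 < u by rewrite /u; lra.
have u_le1 : u <= 1 by rewrite /u; lra.
have den_gt0 : 0 < 77 * u - 27 by lra.
have bbE : bb%:R = expR l by rewrite lnK.
have zE : `|z| = expR (- u * l).
  rewrite /z normrM normfV -intr_norm (ger0_norm (ltW bb_gt0)) bbE -expRN.
  by rewrite -[X in X * _](lnK (x := `|aa|%:~R)) // aaE -expRD /u; congr expR; ring.
have z_lt1 : `|z| < 1 by rewrite zE -expR0 ltr_expR; nra.
have z_neq0 : z != 0 by rewrite -normr_gt0 zE expR_gt0.
have bb_int : (bb%:R : R) \is a Num.int by exact: natr_int.
have zbb_int : z * bb%:R \is a Num.int.
  by rewrite /z divfK ?intr_int // gt_eqF.
have [C [C_gt0 [K bound]]] := levels_bound bb_int zbb_int z_lt1 z_neq0 bb_ge1.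
pose x := (27 + 3 * u) / (77 * u - 27).
have x_ge0 : 0 <= x by rewrite divr_ge0 ?(ltW den_gt0) //; lra.
(* Asking for a gain of ln q + c instead of ln q absorbs C and yields the bound 1/2. *)
pose c := ln (2 * C).
have -> : 80 * (1 - lam) / (50 - 77 * lam) = 1 + x.
  rewrite /x /u; field; rewrite gt_eqF //; lra.
(* The threshold on ln q is the hypothesis of [choose_level] for Y = ln q + c, with 1 added for
   strictness. *)
apply: (@sim_approx_exp_le _ _ _ _ (2 * C * expR (x * c))
  (1 - c + 2 ^+ K * (60 * u - 21) * l)) => //.
  by rewrite !mulr_gt0 ?expR_gt0.
move=> p1 p2 q q_gt0 q_large.
have qR_gt0 : 0 < q%:R :> R by rewrite ltr0n.
have [|k [lv [Kk lv_in E_ge H_le]]] := @choose_level R u l (ln q%:R + c) K u_gt l_gt0.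
  by move: q_large; lra.
have := bound lv k q%:R p1%:~R p2%:~R lv_in Kk (natr_int _ _) (intr_int _ _) (intr_int _ _).
rewrite (gt_eqF qR_gt0) (gtr0_norm qR_gt0) -addrA => /(_ isT).
set D := `|_ - p1%:~R| + `|_ - p2%:~R|.
have D_ge0 : 0 <= D by rewrite addr_ge0.
rewrite normrX zE bbE -!expRM_natl !natrX.
set H := lv.1%:R * (2 ^+ k * l).
have small : C * expR H * (q%:R * expR (lv.2%:R * (2 ^+ k * (- u * l)))) <= 1 / 2.
  rewrite -[q%:R]lnK ?posrE // -mulrA -!expRD -ler_pdivlMl //.
  have -> : C^-1 * (1 / 2) = expR (- c).
    by rewrite /c expRN lnK ?posrE ?mulr_gt0 //; field; rewrite gt_eqF.
  by rewrite ler_expR /H; nra.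
have H_le' : expR H <= expR (x * c) * expR (x * ln q%:R).
  rewrite -expRD ler_expR /H -mulrDr (addrC c); apply: le_trans H_le.
  by rewrite [leLHS](_ : _ = 2 ^+ k * lv.1%:R * l) //; ring.
have main : C * expR H * D <= C * (expR (x * c) * expR (x * ln q%:R)) * D.
  by rewrite ler_wpM2r // ler_wpM2l // ltW.
rewrite mulrDr => total.
have -> : 2 * C * expR (x * c) * expR (x * ln q%:R) * D =
  2 * (C * (expR (x * c) * expR (x * ln q%:R)) * D) by ring.
move: small main total.
set s1 := C * expR H * (_ * _); set s2 := C * expR H * D; set s3 := C * _ * D.
by lra.
Qed.

End Bound.

Theorem theorem1 (R : realType) (a b : nat -> int) :
  is_stern a -> is_twisted_stern b ->
  (forall bb : nat, (2 <= bb)%N ->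
     (sim_approx_exp (shifted_series a (bb%:R^-1 : R))
                     (shifted_series b (bb%:R^-1 : R)) <= (8 / 5)%:E)%E) /\
  (forall (aa : int) (bb : nat) (lam : R), (2 <= bb)%N -> aa != 0 ->
     ln (`|aa|%:~R : R) = lam * ln (bb%:R : R) ->
     0 <= lam -> lam < 50 / 77 ->
     (sim_approx_exp (shifted_series a (aa%:~R / bb%:R : R))
                     (shifted_series b (aa%:~R / bb%:R : R))
        <= (80 * (1 - lam) / (50 - 77 * lam))%:E)%E).
Proof.
move=> /stern_twist_rec a_rec /twisted_stern_twist_rec b_rec.
split; last exact: sim_approx_exp_stern_le.
move=> bb bb_ge2.
(* The first bound is the case a = 1, lambda = 0, where 80/50 = 8/5. *)
have ln1E : ln (`|1 : int|%:~R : R) = 0 * ln (bb%:R : R) by rewrite normr1 ln1 mul0r.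
have lam_lt : 0 < 50 / 77 :> R by lra.
have := sim_approx_exp_stern_le a_rec b_rec bb_ge2 (oner_neq0 int) ln1E (lexx 0) lam_lt.
by rewrite mulr1z mul1r (_ : 80 * _ / _ = 8 / 5) //; field.
Qed.
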